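(* For every $n\in\mathbb{N}$ the graph $G(5,n)$ has a Hamiltonian path, and for every even $n>2$ the graph $G(5,n)$ is Hamiltonian (has a Hamiltonian cycle).
   Context: For a prime $p$ and $n\in\mathbb{N}$, $G(p,n)$ is the simple graph with vertex set $\{2,4,\ldots,2n\}$ in which two distinct vertices $a,b$ are adjacent if and only if both $\frac{a+b}{2}$ and $\frac{|a-b|}{2}$ are odd positive integers neither of which equals $pk$ for an integer $k\ge 2$. *)

(* Defs.v *)
From mathcomp Require Import all_boot all_order all_algebra.

Set Implicit Arguments.
Unset Strict Implicit.
Unset Printing Implicit Defensive.

Record sgraph := SGraph {
  vertex :> finType;
  adj : rel vertex;
  adj_sym : symmetric adj;
  adj_irr : irreflexive adj
}.

(* The path is x :: s, so the empty graph has no Hamiltonian path. *)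
Definition has_hamiltonian_path (G : sgraph) : Prop :=
  exists (x : G) (s : seq G),
    [/\ path (@adj G) x s, uniq (x :: s) & forall y : G, y \in x :: s].

(* [cycle] would accept sequences of size at most 2, which are not cycles of a
   simple graph. *)
Definition hamiltonian (G : sgraph) : Prop :=
  exists c : seq G,
    [/\ 3 <= size c, cycle (@adj G) c, uniq c & forall y : G, y \in c].

(* m = p * k for some integer k >= 2; the bound k <= m loses nothing when
   0 < p, see [proper_multipleP]. *)
Definition proper_multiple (p m : nat) : bool :=
  [exists k : 'I_m.+1, (2 <= k) && (m == p * k)].

Lemma proper_multipleP p m : prime p ->
  reflect (exists k, 2 <= k /\ m = p * k) (proper_multiple p m).
Proof.
move=> p_pr; apply: (iffP existsP) => [[k /andP[k2 /eqP mE]]|[k [k2 mE]]].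
  by exists k.
have km : k < m.+1 by rewrite ltnS mE leq_pmull ?prime_gt0.
by exists (Ordinal km); rewrite /= k2 -mE eqxx.
Qed.

(* Truncated division is exact on the vertices, which are all even. *)
Definition half_sum (a b : nat) : nat := (a + b) %/ 2.
Definition half_dist (a b : nat) : nat := `|a - b|%N %/ 2.

Definition Gadj (p a b : nat) : bool :=
  [&& a != b,
      odd (half_sum a b), ~~ proper_multiple p (half_sum a b),
      odd (half_dist a b) & ~~ proper_multiple p (half_dist a b)].

Definition Gvertices (n : nat) : seq nat := [seq 2 * i | i <- iota 1 n].

Definition Grel (p n : nat) : rel (seq_sub (Gvertices n)) :=
  fun a b => Gadj p (val a) (val b).

Lemma Grel_sym p n : symmetric (@Grel p n).
Proof.
by move=> a b; rewrite /Grel /Gadj /half_sum /half_dist eq_sym addnC distnC.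
Qed.

Lemma Grel_irr p n : irreflexive (@Grel p n).
Proof. by move=> a; rewrite /Grel /Gadj eqxx. Qed.

Definition G (p n : nat) : sgraph := SGraph (@Grel_sym p n) (@Grel_irr p n).

(* Main.v *)
(* Write the vertices as [2 i], [1 <= i <= n].  Then [i] and [j] are adjacent
   when [i + j] is odd and neither [i + j] nor [|i - j|] is a multiple of 5
   other than 5, and for the edges with [5] not dividing [i + j] this is
   invariant under the translation [i -> i + 10].  For [m = 4, 6, 8, 10, 12] we
   take a Hamiltonian path of [1..m] with adjacent ends [a] and [b] which can be
   prolonged at both ends, through [m+1..m+10], up to [a + 10] and [b + 10].
   Translating this prolongation by multiples of 10 and iterating it gives a
   Hamiltonian cycle for every even [n > 2].  For odd [n > 3], the vertex [n] is
   adjacent to [n - 1] or to [n - 3]; opening the cycle of [n - 1] at that vertex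
   gives a Hamiltonian path. *)
Require Import Defs.
From mathcomp Require Import all_boot all_order all_algebra.
From mathcomp Require Import zify.

Set Implicit Arguments.
Unset Strict Implicit.
Unset Printing Implicit Defensive.

Definition good5 (m : nat) : bool := (m == 5) || ~~ (5 %| m).

Definition adj5 : rel nat :=
  fun i j => [&& odd (i + j), good5 (i + j) & good5 `|i - j|%N].

(** Omits the edges of [adj5] with [i + j = 5]: translation by 10 makes that sum a larger multiple
    of 5. *)
Definition tadj5 : rel nat :=
  fun i j => [&& odd (i + j), ~~ (5 %| i + j) & good5 `|i - j|%N].

Lemma good5_not_proper_multiple m : good5 m -> ~~ proper_multiple 5 m.
Proof.
by move=> gm; apply/(proper_multipleP m (isT : prime 5)); case=> k; move: gm;
  rewrite /good5; lia.
Qed.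

(** [i + j] and [|i - j|] have the same parity, so one oddness test covers both and excludes
    [i = j]. *)
Lemma adj5_Gadj i j : adj5 i j -> Gadj 5 (2 * i) (2 * j).
Proof.
case/and3P=> odd_ij gS gD; rewrite /Gadj.
have -> : half_sum (2 * i) (2 * j) = i + j by rewrite /half_sum; lia.
have -> : half_dist (2 * i) (2 * j) = `|i - j|%N by rewrite /half_dist; lia.
by rewrite !good5_not_proper_multiple // odd_ij andbT; lia.
Qed.

Lemma tadj5_adj5 : subrel tadj5 adj5.
Proof. by move=> i j /and3P[o s d]; rewrite /adj5 o d /good5 s orbT. Qed.

Lemma tadj5_translate k i j : tadj5 (10 * k + i) (10 * k + j) = tadj5 i j.
Proof.
rewrite /tadj5 /good5.
have -> : `|10 * k + i - (10 * k + j)|%N = `|i - j|%N by lia.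
have -> : odd (10 * k + i + (10 * k + j)) = odd (i + j) by lia.
by have -> : 5 %| 10 * k + i + (10 * k + j) = (5 %| i + j) by lia.
Qed.

Lemma path_translate k x s :
  path tadj5 x s -> path adj5 (10 * k + x) (map (addn (10 * k)) s).
Proof.
apply: homo_path => i j ij.
by apply: tadj5_adj5; rewrite tadj5_translate.
Qed.

Lemma lift_vertices n (s : seq nat) : perm_eq s (iota 1 n) ->
  exists t : seq (G 5 n),
    [/\ map val t = map (muln 2) s, uniq t & forall y, y \in t].
Proof.
move=> s_n.
have s2_n : perm_eq (map (muln 2) s) (Gvertices n) by exact: perm_map.
(* Every [2 * i] here is a vertex, so [pmap] discards nothing. *)
pose t : seq (G 5 n) := pmap insub (map (muln 2) s).
have tE : map val t = map (muln 2) s.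
  rewrite (pmap_filter (insubK _)); apply/all_filterP/allP => x.
  by rewrite (perm_mem s2_n) => x_n; rewrite insubT.
exists t; split=> //; last first.
  by move=> y; rewrite -(mem_map val_inj) tE (perm_mem s2_n) (valP y).
rewrite -(map_inj_uniq val_inj) tE map_inj_uniq ?(perm_uniq s_n) ?iota_uniq //.
by move=> i j; lia.
Qed.

Lemma adj5_hamiltonian_path n x s :
  path adj5 x s -> perm_eq (x :: s) (iota 1 n) -> has_hamiltonian_path (G 5 n).
Proof.
move=> path_s /lift_vertices [[|y t] [//]].
rewrite !map_cons => -[yE tE] t_uniq t_all.
exists y, t; split=> //.
have : path (Gadj 5) (2 * x) (map (muln 2) s).
  by apply: homo_path path_s => i j; apply: adj5_Gadj.
by rewrite -yE -tE path_map.
Qed.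

Lemma adj5_hamiltonian n c : 2 < n ->
  cycle adj5 c -> perm_eq c (iota 1 n) -> hamiltonian (G 5 n).
Proof.
move=> n_gt2 cycle_c c_n; have [t [tE t_uniq t_all]] := lift_vertices c_n.
exists t; split=> //.
  by rewrite -(size_map val) tE size_map (perm_size c_n) size_iota.
have : cycle (Gadj 5) (map (muln 2) c).
  by apply: homo_cycle cycle_c => i j; apply: adj5_Gadj.
by rewrite -tE cycle_map.
Qed.

(** Only the prolongations [l] and [r] get translated, hence [tadj5] for them; [s] serves once, at
    [k = 0], so [adj5] suffices there. *)
Lemma adj5_iterated_path m a b s l r :
    path adj5 a s -> last a s = b -> perm_eq (a :: s) (iota 1 m) ->
    path tadj5 (10 + a) (rcons l a) -> path tadj5 b r -> last b r = 10 + b ->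
    perm_eq (10 + a :: l ++ r) (iota m.+1 10) ->
  forall k, exists t, [/\ path adj5 (10 * k + a) t,
    last (10 * k + a) t = 10 * k + b &
    perm_eq (10 * k + a :: t) (iota 1 (10 * k + m))].
Proof.
move=> path_s last_s s_m path_l path_r last_r lr_m; elim=> [|k [t []]].
  by exists s.
move=> path_t last_t t_m; pose f := addn (10 * k).
have fS x : 10 * k.+1 + x = f (10 + x) by rewrite /f; lia.
(* From [f (10 + a)] via [l] to [f a], along the previous path to [f b], then via [r] to
   [f (10 + b)]. *)
exists (map f l ++ f a :: t ++ map f r); rewrite !fS; split.
- have := path_translate k path_l.
  rewrite map_rcons rcons_path => /andP[path_fl adj_la].
  rewrite cat_path path_fl /= cat_path adj_la path_t last_t /=.
  exact: path_translate.
- by rewrite last_cat /= last_cat last_t (last_map f r b) last_r.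
- have -> : f (10 + m) = f m + 10 by rewrite /f; lia.
  have fr_m : perm_eq (map f (10 + a :: l ++ r)) (iota (1 + f m) 10).
    have -> : 1 + f m = f m.+1 by rewrite /f; lia.
    by rewrite iotaDl perm_map.
  rewrite iotaD -cat_cons -[f a :: _]cat_cons -[f (10 + a) :: _]/(map f (_ :: l)).
  (* The old block [f a :: t] moves to the front; the two prolongations fill the last ten
     integers. *)
  rewrite perm_catCA perm_cat //.
  by rewrite -map_cat.
Qed.

Lemma adj5_iterated_cycle m a b s l r :
    path adj5 a s -> last a s = b -> perm_eq (a :: s) (iota 1 m) ->
    path tadj5 (10 + a) (rcons l a) -> path tadj5 b r -> last b r = 10 + b ->
    perm_eq (10 + a :: l ++ r) (iota m.+1 10) -> tadj5 b a ->
  forall k, exists2 c, cycle adj5 c & perm_eq c (iota 1 (10 * k + m)).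
Proof.
move=> path_s last_s s_m path_l path_r last_r lr_m adj_ba k.
have [t [path_t last_t t_m]] :=
  adj5_iterated_path path_s last_s s_m path_l path_r last_r lr_m k.
exists (10 * k + a :: t) => //=; rewrite rcons_path path_t last_t /=.
by apply: tadj5_adj5; rewrite tadj5_translate.
Qed.

Lemma adj5_cycle n : 2 < n -> ~~ odd n ->
  exists2 c, cycle adj5 c & perm_eq c (iota 1 n).
Proof.
move=> n_gt2 n_even; set k := (n - 4) %/ 10.
have : n \in [:: 10 * k + 4; 10 * k + 6; 10 * k + 8; 10 * k + 10; 10 * k + 12].
  by rewrite /k !inE; lia.
rewrite !inE => /or4P[|||/orP[]] /eqP ->.
(* In all five cases [a = m]; the conditions on the explicit lists hold by computation. *)
- exact: (@adj5_iterated_cycle 4 4 3 [:: 1; 2; 3]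
    [:: 7] [:: 6; 5; 8; 9; 12; 11; 10; 13]).
- exact: (@adj5_iterated_cycle 6 6 5 [:: 1; 2; 3; 4; 5]
    [:: 13] [:: 8; 9; 10; 11; 12; 7; 14; 15]).
- exact: (@adj5_iterated_cycle 8 8 5 [:: 1; 2; 3; 4; 7; 6; 5]
    [:: 13] [:: 12; 9; 10; 11; 16; 17; 14; 15]).
- exact: (@adj5_iterated_cycle 10 10 9 [:: 1; 2; 3; 4; 7; 6; 5; 8; 9]
    [:: 17] [:: 12; 11; 16; 13; 14; 15; 18; 19]).
- exact: (@adj5_iterated_cycle 12 12 11 [:: 1; 2; 3; 4; 5; 6; 7; 10; 9; 8; 11]
    [:: 17] [:: 16; 13; 14; 15; 18; 19; 20; 21]).
Qed.

(** [n - 1] fails only if 5 divides [2n - 1], that is [n = 3] modulo 5; then [2n - 3] is 3 modulo 5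
    and [n - 3] works. *)
Lemma adj5_earlier_neighbor n : 3 < n -> exists2 j, 0 < j < n & adj5 n j.
Proof.
move=> n_gt3; have [n3 | n3] := eqVneq (n %% 5) 3.
  by exists (n - 3); rewrite /adj5 /good5; lia.
by exists n.-1; rewrite /adj5 /good5; lia.
Qed.

Theorem theorem5p5 :
  (forall n : nat, 0 < n -> has_hamiltonian_path (G 5 n)) /\
  (forall n : nat, 2 < n -> ~~ odd n -> hamiltonian (G 5 n)).
Proof.
split=> n n_gt; last first.
  by move=> n_even; have [c] := adj5_cycle n_gt n_even; apply: adj5_hamiltonian.
have [n_le3 | n_gt3] := leqP n 3.
  case: n n_gt n_le3 => [|[|[|[|]]]] // _ _.
  - exact: (@adj5_hamiltonian_path _ 1 [::]).
  - exact: (@adj5_hamiltonian_path _ 1 [:: 2]).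
  - exact: (@adj5_hamiltonian_path _ 1 [:: 2; 3]).
have [n_odd | n_even] := boolP (odd n); last first.
  have [[|x s]] := adj5_cycle (ltnW n_gt3) n_even.
    by move=> _ /perm_size; rewrite size_iota /=; lia.
  by rewrite /= rcons_path => /andP[path_s _]; apply: adj5_hamiltonian_path.
have [|| c cycle_c c_n] := @adj5_cycle n.-1; [lia | lia |].
have [j j_n adj_nj] := adj5_earlier_neighbor n_gt3.
have : j \in c by rewrite (perm_mem c_n) mem_iota; lia.
(* The cycle is rotated to start at [j] and loses its closing edge; [n] is put in front. *)
case/rot_to=> i s rot_c; apply: (@adj5_hamiltonian_path _ n (j :: s)).
  move: cycle_c; rewrite -(rot_cycle i) rot_c /= rcons_path adj_nj.
  by case/andP.
rewrite -rot_c -cat1s perm_catC (_ : n = n.-1 + 1) ?iotaD; last lia.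
by rewrite perm_cat ?perm_rot // (_ : 1 + n.-1 = n.-1 + 1) // addnC.
Qed.
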